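(* Let $\Upsilon_2$ be the free monoid of rank $2$, let $\mathrm{Rep}_2(2)_B:=\mathrm{Rep}_2(\Upsilon_2)_B$, and let $\mathcal{L}_2:=\mathcal{L}_{\Upsilon_2}$ be the universal sub-line bundle on $\mathrm{Rep}_2(2)_B$. Then $\mathcal{L}_2^{\otimes 2}\cong \mathcal{O}_{\mathrm{Rep}_2(2)_B}$.
   Context: Let $X$ be a scheme. A representation of degree $n$ for a group (resp. monoid) $\Gamma$ on $X$ is a group homomorphism $\rho:\Gamma\to \mathrm{GL}_n(\Gamma(X,\mathcal{O}_X))$ (resp. a monoid homomorphism $\rho:\Gamma\to \mathrm{M}_n(\Gamma(X,\mathcal{O}_X))$). A mold of degree $n$ on $X$ is a subsheaf of $\mathcal{O}_X$-algebras (containing the identity matrix) $\mathcal{A}\subseteq \mathrm{M}_n(\mathcal{O}_X)$ such that $\mathcal{A}$ and $\mathrm{M}_n(\mathcal{O}_X)/\mathcal{A}$ are locally free sheaves. Two molds $\mathcal{A},\mathcal{B}$ of degree $n$ on $X$ are locally equivalent if every $x\in X$ has an open neighborhood $U$ and some $P_U\in \mathrm{GL}_n(\mathcal{O}_U)$ with $P_U^{-1}(\mathcal{A}|_U)P_U=\mathcal{B}|_U$. Let $\mathcal{B}_n\subset \mathrm{M}_n(\mathbb{Z})$ be the subalgebra of upper triangular matrices. A Borel mold of degree $n$ on $X$ is a mold locally equivalent to $\mathcal{B}_n\otimes_{\mathbb{Z}}\mathcal{O}_X$. A representation with Borel mold on $X$ is a representation $\rho$ of degree $n$ on $X$ such that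 the subsheaf of $\mathcal{O}_X$-algebras $\mathcal{O}_X[\rho(\Gamma)]\subseteq \mathrm{M}_n(\mathcal{O}_X)$ generated by $\rho(\Gamma)$ is a Borel mold. $\mathrm{Rep}_n(\Gamma)_B$ is the scheme over $\mathbb{Z}$ representing the contravariant functor sending a scheme $X$ to the set of degree $n$ representations with Borel mold for $\Gamma$ on $X$; it is a subscheme of the affine scheme $\mathrm{Rep}_n(\Gamma)$ representing all degree $n$ representations of $\Gamma$. The universal representation makes $\Gamma$ act on the trivial bundle $\mathcal{O}^{\oplus n}_{\mathrm{Rep}_n(\Gamma)_B}$ (via $\mathrm{M}_n(\Gamma(X,\mathcal{O}_X))=\mathrm{End}_{\mathcal{O}_X}(\mathcal{O}_X^{\oplus n})$ with $X=\mathrm{Rep}_n(\Gamma)_B$). A subbundle of $\mathcal{O}_X^{\oplus n}$ is a locally free subsheaf with locally free quotient. For $n=2$ there is a unique $\Gamma$-invariant rank $1$ subbundle $\mathcal{L}_\Gamma\subset \mathcal{O}_{\mathrm{Rep}_2(\Gamma)_B}^{\oplus 2}$, called the universal sub-line bundle on $\mathrm{Rep}_2(\Gamma)_B$. *)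

(* Defs.v *)
From HB Require Import structures.
From mathcomp Require Import all_boot all_order all_algebra.
From mathcomp Require Import boolp classical_sets functions topology.

Set Implicit Arguments.
Unset Strict Implicit.
Unset Printing Implicit Defensive.

Import GRing.Theory.
Local Open Scope classical_set_scope.
Local Open Scope ring_scope.

Record opens (T : topologicalType) := Opens {
  oset :> set T;
  oset_open : open oset
}.

Definition opensT (T : topologicalType) : opens T := Opens (@openT T).

Definition opensI (T : topologicalType) (U V : opens T) : opens T :=
  Opens (openI (oset_open U) (oset_open V)).

Definition opens_preim (T S : topologicalType) (f : T -> S)
    (fc : continuous f) (U : opens S) : opens T :=
  Opens (open_comp (fun x _ => fc x) (oset_open U)).

Definition sheaf_condition (T : topologicalType) (F : opens T -> Type)
    (res : forall U V : opens T, V `<=` U -> F U -> F V) : Prop :=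
  forall (U : opens T) (I : Type) (W : I -> opens T)
    (WU : forall i, W i `<=` U),
    U `<=` \bigcup_i W i ->
  forall s : forall i, F (W i),
    (forall i j,
      res _ (opensI (W i) (W j)) (@subIsetl _ _ _) (s i) =
      res _ (opensI (W i) (W j)) (@subIsetr _ _ _) (s j)) ->
  exists! t : F U, forall i, res _ _ (WU i) t = s i.

(* The zero ring must be allowed (sections over the empty set), hence
   [comPzRingType]. *)
Record ringedSpace := RingedSpace {
  rs_top :> topologicalType;
  rs_sec : opens rs_top -> comPzRingType;
  rs_res : forall U V : opens rs_top,
    V `<=` U -> {rmorphism rs_sec U -> rs_sec V};
  rs_res_id : forall (U : opens rs_top) (h : U `<=` U) s, rs_res h s = s;
  rs_res_comp : forall (U V W : opens rs_top)
    (hUV : V `<=` U) (hVW : W `<=` V) (hUW : W `<=` U) s,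
    rs_res hVW (rs_res hUV s) = rs_res hUW s;
  rs_sheaf : sheaf_condition (fun U V h => rs_res h : rs_sec U -> rs_sec V)
}.

Notation "''O' ( U )" := (rs_sec U) (at level 8, format "''O' ( U )").
Notation globsec X := (@rs_sec X (opensT X)).

Definition is_unit (R : comPzRingType) (r : R) : Prop := exists r', r * r' = 1.

(* A germ is a unit of the stalk (a filtered colimit of rings) iff the section
   is invertible on some neighbourhood. *)
Definition germ_unit (X : ringedSpace) (x : X) (U : opens X) (s : 'O(U)) :
    Prop :=
  exists (V : opens X) (h : V `<=` U), oset V x /\ is_unit (rs_res h s).

(* The stalk at x is a local ring: it is nonzero, and a or 1 - a is a unit for
   each element a. *)
Definition stalk_local (X : ringedSpace) (x : X) : Prop :=
  forall U : opens X, oset U x ->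
    (1 : 'O(U)) <> 0 /\
    forall s : 'O(U), germ_unit x s \/ germ_unit x (1 - s).

Record primeIdeal (A : comPzRingType) := PrimeIdeal {
  pi_set : set A;
  pi_0 : pi_set 0;
  pi_D : forall a b, pi_set a -> pi_set b -> pi_set (a + b);
  pi_M : forall a b, pi_set b -> pi_set (a * b);
  pi_1 : ~ pi_set 1;
  pi_prime : forall a b, pi_set (a * b) -> pi_set a \/ pi_set b
}.

HB.instance Definition _ (A : comPzRingType) := gen_eqMixin (primeIdeal A).
HB.instance Definition _ (A : comPzRingType) := gen_choiceMixin (primeIdeal A).

Definition basic_open (A : comPzRingType) (f : A) : set (primeIdeal A) :=
  [set p | ~ pi_set p f].

Section Zariski.
Variable A : comPzRingType.

Definition zariski_open (S : set (primeIdeal A)) : Prop :=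
  forall p, S p -> exists2 f, basic_open f p & basic_open f `<=` S.

Let zariski_openT : zariski_open setT.
Proof. by move=> p _; exists 1 => //; exact: pi_1. Qed.

Let zariski_openI : setI_closed zariski_open.
Proof.
move=> S S' oS oS' p [/oS[f fp fS] /oS'[g gp gS']].
exists (f * g) => [/pi_prime[]//|q qfg]; split; [apply: fS|apply: gS'] => h.
  by apply: qfg; rewrite mulrC; exact: pi_M.
by apply: qfg; exact: pi_M.
Qed.

Let zariski_open_bigU (I : Type) (S : I -> set (primeIdeal A)) :
  (forall i, zariski_open (S i)) -> zariski_open (\bigcup_i S i).
Proof.
move=> oS p [i _ /oS[f fp fS]].
by exists f => // q /fS Sq; exists i.
Qed.

HB.instance Definition _ := isOpenTopological.Build (primeIdeal A)
  zariski_openT zariski_openI zariski_open_bigU.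

End Zariski.

(* [j] exhibits [B] as the localization of [A] at the powers of [f]. *)
Definition is_localization_away (A B : comPzRingType) (j : A -> B) (f : A) :
    Prop :=
  [/\ is_unit (j f),
      forall b, exists a k, b * j f ^+ k = j a
    & forall a, j a = 0 -> exists k, f ^+ k * a = 0].

(* (U, O_X|_U) is isomorphic to (Spec A, O_(Spec A)) for some ring A: [phi] is a
   homeomorphism from Spec A onto U, and, the structure sheaf of Spec A being
   the sheaf with value A_f on D(f), the isomorphism of sheaves is a ring
   morphism A -> O_X(U) inducing A_f = O_X(phi(D(f))) for all f. *)
Definition affine_open (X : ringedSpace) (U : opens X) : Prop :=
  exists (A : comPzRingType) (phi : primeIdeal A -> X)
         (j : {rmorphism A -> 'O(U)}),
    [/\ injective phi, range phi = U, continuous phi,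
        forall S : set (primeIdeal A), open S -> open (phi @` S)
      & forall (f : A) (V : opens X) (h : V `<=` U),
          oset V = phi @` basic_open f ->
          is_localization_away (fun a => rs_res h (j a)) f].

Record scheme := Scheme {
  sch_rs :> ringedSpace;
  sch_local : forall x : sch_rs, stalk_local x;
  sch_affine : forall x : sch_rs,
    exists2 U : opens sch_rs, oset U x & affine_open U
}.

Record schemeMor (Y X : scheme) := SchemeMor {
  sm_fun :> Y -> X;
  sm_cont : continuous sm_fun;
  sm_com : forall U : opens X,
    {rmorphism 'O(U) -> 'O(opens_preim sm_cont U)};
  sm_nat : forall (U V : opens X) (h : V `<=` U)
    (h' : opens_preim sm_cont V `<=` opens_preim sm_cont U) s,
    rs_res h' (sm_com U s) = sm_com V (rs_res h s);
  sm_local : forall (y : Y) (U : opens X) (s : 'O(U)), oset U (sm_fun y) ->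
    germ_unit y (sm_com U s) -> germ_unit (sm_fun y) s
}.

Arguments sm_cont {Y X} _.
Arguments sm_com {Y X} _ _.

Definition glob_pull (Y X : scheme) (f : schemeMor Y X) (s : globsec X) :
    globsec Y :=
  rs_res (fun _ _ => I : oset (opens_preim (sm_cont f) (opensT X)) _)
    (sm_com f (opensT X) s).

Record modSheaf (X : ringedSpace) := ModSheaf {
  ms_sec :> forall U : opens X, lmodType 'O(U);
  ms_res : forall U V : opens X, V `<=` U -> ms_sec U -> ms_sec V;
  ms_resD : forall (U V : opens X) (h : V `<=` U) u v,
    ms_res h (u + v) = ms_res h u + ms_res h v;
  ms_resZ : forall (U V : opens X) (h : V `<=` U) a u,
    ms_res h (a *: u) = rs_res h a *: ms_res h u;
  ms_res_id : forall (U : opens X) (h : U `<=` U) s, ms_res h s = s;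
  ms_res_comp : forall (U V W : opens X)
    (hUV : V `<=` U) (hVW : W `<=` V) (hUW : W `<=` U) s,
    ms_res hVW (ms_res hUV s) = ms_res hUW s;
  ms_sheaf : sheaf_condition ms_res
}.

Record modMor (X : ringedSpace) (F G : modSheaf X) := ModMor {
  mm_fun :> forall U : opens X, F U -> G U;
  mm_funD : forall U (u v : F U), mm_fun (u + v) = mm_fun u + mm_fun v;
  mm_funZ : forall U (a : 'O(U)) (u : F U), mm_fun (a *: u) = a *: mm_fun u;
  mm_nat : forall (U V : opens X) (h : V `<=` U) (u : F U),
    mm_fun (ms_res h u) = ms_res h (mm_fun u)
}.

Definition mod_iso (X : ringedSpace) (F G : modSheaf X) : Prop :=
  exists (f : modMor F G) (g : modMor G F),
    forall U : opens X, cancel (@mm_fun _ _ _ f U) (@mm_fun _ _ _ g U) /\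
                        cancel (@mm_fun _ _ _ g U) (@mm_fun _ _ _ f U).

(* An isomorphism between (O_U)^r and F|_U, given by the images [e] of the
   standard basis. *)
Definition free_over (X : ringedSpace) (F : modSheaf X) (U : opens X) (r : nat) :
    Prop :=
  exists e : 'I_r -> F U,
    forall (V : opens X) (h : V `<=` U) (s : F V),
      exists! c : 'rV['O(V)]_r, s = \sum_i c 0 i *: ms_res h (e i).

Definition locally_free (X : ringedSpace) (F : modSheaf X) : Prop :=
  forall x : X, exists2 U : opens X, oset U x & exists r, free_over F U r.

Definition locally_free_of_rank (X : ringedSpace) (F : modSheaf X) (r : nat) :
    Prop :=
  forall x : X, exists2 U : opens X, oset U x & free_over F U r.

Record bilinMor (X : ringedSpace) (F G H : modSheaf X) := BilinMor {
  bm_fun :> forall U : opens X, F U -> G U -> H U;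
  bm_funDl : forall U (u u' : F U) (v : G U),
    bm_fun (u + u') v = bm_fun u v + bm_fun u' v;
  bm_funDr : forall U (u : F U) (v v' : G U),
    bm_fun u (v + v') = bm_fun u v + bm_fun u v';
  bm_funZl : forall U (a : 'O(U)) (u : F U) (v : G U),
    bm_fun (a *: u) v = a *: bm_fun u v;
  bm_funZr : forall U (a : 'O(U)) (u : F U) (v : G U),
    bm_fun u (a *: v) = a *: bm_fun u v;
  bm_nat : forall (U V : opens X) (h : V `<=` U) (u : F U) (v : G U),
    bm_fun (ms_res h u) (ms_res h v) = ms_res h (bm_fun u v)
}.

(* The tensor product over O_X, by its universal property. *)
Definition is_tensor_product (X : ringedSpace) (F G T : modSheaf X)
    (t : bilinMor F G T) : Prop :=
  forall (H : modSheaf X) (b : bilinMor F G H),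
    exists! f : modMor T H, forall U (u : F U) (v : G U), f U (t U u v) = b U u v.

Definition structure_sheaf (X : ringedSpace) : modSheaf X :=
  @ModSheaf X (fun U => 'O(U)^o) (fun U V h => @rs_res X U V h)
    (fun U V h u v => rmorphD (rs_res h) u v)
    (fun U V h a u => rmorphM (rs_res h) a u)
    (@rs_res_id X) (@rs_res_comp X) (@rs_sheaf X).

Section MatrixSheaf.
Variables (X : ringedSpace) (m n : nat).

Let res (U V : opens X) (h : V `<=` U) (M : 'M['O(U)]_(m, n)) :
  'M['O(V)]_(m, n) := map_mx (rs_res h) M.

Let resD (U V : opens X) (h : V `<=` U) u v : res h (u + v) = res h u + res h v.
Proof. by apply/matrixP => i j; rewrite !mxE rmorphD. Qed.

Let resZ (U V : opens X) (h : V `<=` U) a u :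
  res h (a *: u) = rs_res h a *: res h u.
Proof. by apply/matrixP => i j; rewrite !mxE rmorphM. Qed.

Let res_id (U : opens X) (h : U `<=` U) s : res h s = s.
Proof. by apply/matrixP => i j; rewrite !mxE rs_res_id. Qed.

Let res_comp (U V W : opens X)
    (hUV : V `<=` U) (hVW : W `<=` V) (hUW : W `<=` U) s :
  res hVW (res hUV s) = res hUW s.
Proof.
by apply/matrixP => i j; rewrite !mxE (rs_res_comp hUV hVW hUW).
Qed.

Let res_sheaf : sheaf_condition res.
Proof.
move=> U I W WU cov s comp.
have glue i j : exists t : 'O(U), forall k, rs_res (WU k) t = s k i j.
  have [|t [ht _]] :=
    @rs_sheaf X U I W WU cov (fun k => s k i j); last by exists t.
  by move=> k l; have /matrixP/(_ i j) := comp k l; rewrite !mxE.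
have tE i j k : rs_res (WU k) (projT1 (cid (glue i j))) = s k i j.
  exact: (projT2 (cid (glue i j)) k).
exists (\matrix_(i, j) projT1 (cid (glue i j))); split=> [k|t ht].
  by apply/matrixP => i j; rewrite !mxE tE.
apply/matrixP => i j; rewrite mxE.
have [|t0 [_ t0u]] := @rs_sheaf X U I W WU cov (fun k => s k i j).
  by move=> k l; have /matrixP/(_ i j) := comp k l; rewrite !mxE.
rewrite -(t0u _ (tE i j)); apply: t0u => k.
by rewrite -(ht k) mxE.
Qed.

Definition matrix_sheaf : modSheaf X :=
  @ModSheaf X (fun U => 'M['O(U)]_(m, n)) res resD resZ res_id res_comp
    res_sheaf.

End MatrixSheaf.

(* O_X^n, as columns, so that M_n(O_X) acts on the left. *)
Definition free_sheaf (X : ringedSpace) (n : nat) : modSheaf X :=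
  matrix_sheaf X n 1.

Record submodule (R : pzRingType) (M : lmodType R) := Submodule {
  subm_set : set M;
  subm_0 : subm_set 0;
  subm_D : forall u v, subm_set u -> subm_set v -> subm_set (u + v);
  subm_Z : forall a u, subm_set u -> subm_set (a *: u)
}.

Definition subm_pred (R : pzRingType) (M : lmodType R) (N : submodule M) :
  pred M := fun u => `[< subm_set N u >].

Section SubmType.
Variables (R : pzRingType) (M : lmodType R) (N : submodule M).

Let subm_pred_closed : submod_closed (subm_pred N).
Proof.
split=> [|a u v /asboolP Nu /asboolP Nv]; apply/asboolP; first exact: subm_0.
by apply: subm_D => //; exact: subm_Z.
Qed.

HB.instance Definition _ :=
  GRing.isSubmodClosed.Build R M (subm_pred N) subm_pred_closed.

Definition subm_type : Type := {u : M | subm_pred N u}.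

HB.instance Definition _ := [isSub of subm_type for @sval M (subm_pred N)].
HB.instance Definition _ := [Choice of subm_type by <:].
HB.instance Definition _ := [SubChoice_isSubLmodule of subm_type by <:].

Definition subm_val (u : subm_type) : M := sval u.

Definition subm_elt (u : M) (Nu : subm_set N u) : subm_type :=
  exist (subm_pred N) u (introT (asboolP _) Nu).

Lemma subm_valP (u : subm_type) : subm_set N (subm_val u).
Proof. by case: u => u /= /asboolP. Qed.

Lemma subm_val_inj : injective subm_val.
Proof. exact: val_inj. Qed.

End SubmType.

Record subSheaf (X : ringedSpace) (F : modSheaf X) := SubSheaf {
  ss_sec :> forall U : opens X, submodule (F U);
  ss_res : forall (U V : opens X) (h : V `<=` U) u,
    subm_set (ss_sec U) u -> subm_set (ss_sec V) (ms_res h u);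
  ss_glue : forall (U : opens X) (u : F U),
    (forall x, oset U x -> exists (V : opens X) (h : V `<=` U),
        oset V x /\ subm_set (ss_sec V) (ms_res h u)) ->
    subm_set (ss_sec U) u
}.

Section SubSheafSheaf.
Variables (X : ringedSpace) (F : modSheaf X) (A : subSheaf F).

Let res (U V : opens X) (h : V `<=` U) (u : subm_type (A U)) : subm_type (A V) :=
  subm_elt (ss_res h (subm_valP u)).

Let resD (U V : opens X) (h : V `<=` U) u v : res h (u + v) = res h u + res h v.
Proof. by apply: subm_val_inj; exact: ms_resD. Qed.

Let resZ (U V : opens X) (h : V `<=` U) a u :
  res h (a *: u) = rs_res h a *: res h u.
Proof. by apply: subm_val_inj; exact: ms_resZ. Qed.

Let res_id (U : opens X) (h : U `<=` U) s : res h s = s.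
Proof. by apply: subm_val_inj; exact: ms_res_id. Qed.

Let res_comp (U V W : opens X)
    (hUV : V `<=` U) (hVW : W `<=` V) (hUW : W `<=` U) s :
  res hVW (res hUV s) = res hUW s.
Proof. by apply: subm_val_inj; exact: ms_res_comp. Qed.

Let res_sheaf : sheaf_condition res.
Proof.
move=> U I W WU cov s comp.
have [|t [ht tu]] := @ms_sheaf X F U I W WU cov (fun k => subm_val (s k)).
  by move=> i j; exact: (congr1 (@subm_val _ _ _) (comp i j)).
have At : subm_set (A U) t.
  apply: ss_glue => x /cov[i _ Wix]; exists (W i), (WU i); split=> //.
  by rewrite ht; exact: subm_valP.
exists (subm_elt At); split=> [k|t' ht']; first by apply: subm_val_inj; exact: ht.
by apply: subm_val_inj; apply: tu => k; rewrite -(ht' k).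
Qed.

Definition subsheaf_sheaf : modSheaf X :=
  @ModSheaf X (fun U => subm_type (A U)) res resD resZ res_id res_comp res_sheaf.

End SubSheafSheaf.

(* [pi] exhibits [Q] as the quotient sheaf F / A, that is
   0 -> A -> F -> Q -> 0 is an exact sequence of sheaves. *)
Definition is_quotient (X : ringedSpace) (F : modSheaf X) (A : subSheaf F)
    (Q : modSheaf X) (pi : modMor F Q) : Prop :=
  (forall (U : opens X) (u : F U), pi U u = 0 <-> subm_set (A U) u) /\
  (forall (U : opens X) (q : Q U) x, oset U x ->
     exists (V : opens X) (h : V `<=` U),
       oset V x /\ exists u : F V, pi V u = ms_res h q).

Definition locally_free_quotient (X : ringedSpace) (F : modSheaf X)
    (A : subSheaf F) : Prop :=
  exists (Q : modSheaf X) (pi : modMor F Q), is_quotient A pi /\ locally_free Q.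

Definition is_subbundle (X : ringedSpace) (F : modSheaf X) (A : subSheaf F) :
    Prop :=
  locally_free (subsheaf_sheaf A) /\ locally_free_quotient A.

Definition is_subalgebra (X : ringedSpace) (n : nat)
    (A : subSheaf (matrix_sheaf X n n)) : Prop :=
  forall U : opens X,
    subm_set (A U) (1%:M : 'M['O(U)]_n) /\
    forall M N : 'M['O(U)]_n,
      subm_set (A U) M -> subm_set (A U) N -> subm_set (A U) (M *m N).

Definition is_mold (X : ringedSpace) (n : nat)
    (A : subSheaf (matrix_sheaf X n n)) : Prop :=
  [/\ is_subalgebra A, locally_free (subsheaf_sheaf A)
    & locally_free_quotient A].

Definition locally_equivalent (X : ringedSpace) (n : nat)
    (A B : subSheaf (matrix_sheaf X n n)) : Prop :=
  forall x : X, exists2 U : opens X, oset U x &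
    exists P P' : 'M['O(U)]_n,
      [/\ P *m P' = 1%:M, P' *m P = 1%:M
        & forall (V : opens X) (h : V `<=` U),
            [set map_mx (rs_res h) P' *m M *m map_mx (rs_res h) P
               | M in subm_set (A V)] = subm_set (B V)].

Section Borel.
Variables (X : ringedSpace) (n : nat).

Definition upper_triangular (R : pzRingType) : set 'M[R]_n :=
  [set M | forall i j : 'I_n, (j < i)%N -> M i j = 0].

Let upper_0 (R : pzRingType) : upper_triangular (0 : 'M[R]_n).
Proof. by move=> i j _; rewrite mxE. Qed.

Let upper_D (R : pzRingType) (M N : 'M[R]_n) :
  upper_triangular M -> upper_triangular N -> upper_triangular (M + N).
Proof. by move=> hM hN i j ji; rewrite mxE hM// hN// addr0. Qed.

Let upper_Z (R : pzRingType) (a : R) (M : 'M[R]_n) :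
  upper_triangular M -> upper_triangular (a *: M).
Proof. by move=> hM i j ji; rewrite mxE hM// mulr0. Qed.

Let sec (U : opens X) : submodule (matrix_sheaf X n n U) :=
  Submodule (M := 'M['O(U)]_n)
    (@upper_0 'O(U)) (@upper_D 'O(U)) (@upper_Z 'O(U)).

Let sec_res (U V : opens X) (h : V `<=` U) (M : matrix_sheaf X n n U) :
  subm_set (sec U) M -> subm_set (sec V) (ms_res h M).
Proof. by move=> hM i j ji; rewrite mxE hM// rmorph0. Qed.

Let sec_glue (U : opens X) (M : matrix_sheaf X n n U) :
  (forall x, oset U x -> exists (V : opens X) (h : V `<=` U),
      oset V x /\ subm_set (sec V) (ms_res h M)) ->
  subm_set (sec U) M.
Proof.
move=> loc i j ji.
pose I := {V : opens X | exists h : V `<=` U, subm_set (sec V) (ms_res h M)}.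
pose W (k : I) := sval k.
have WU (k : I) : W k `<=` U by case: (svalP k).
have cov : U `<=` \bigcup_k W k.
  by move=> x /loc[V [h [Vx hV]]]; exists (exist _ V (ex_intro _ h hV)).
have [|t [_ tu]] := @rs_sheaf X U I W WU cov (fun=> 0).
  by move=> k l /=; rewrite !rmorph0.
rewrite -(tu 0) => [|k]; last by rewrite rmorph0.
apply/esym/tu => k; case: (svalP k) => h /(_ i j ji).
by rewrite mxE => <-; congr (rs_res _ _); exact: Prop_irrelevance.
Qed.

(* B_n ⊗ O_X: the subsheaf of upper triangular matrices with entries in O_X. *)
Definition upper_sheaf : subSheaf (matrix_sheaf X n n) :=
  SubSheaf sec_res sec_glue.

End Borel.

Definition is_borel_mold (X : ringedSpace) (n : nat)
    (A : subSheaf (matrix_sheaf X n n)) : Prop :=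
  is_mold A /\ locally_equivalent A (upper_sheaf X n).

Definition is_representation (G : monoidType) (n : nat) (X : ringedSpace)
    (rho : G -> 'M[globsec X]_n) : Prop :=
  rho 1%g = 1%:M /\ forall g h, rho (g * h)%g = rho g *m rho h.

Definition rep_res (G : monoidType) (n : nat) (X : ringedSpace)
    (rho : G -> 'M[globsec X]_n) (U : opens X) (g : G) : 'M['O(U)]_n :=
  map_mx (@rs_res X (opensT X) U (@subsetT X U)) (rho g).

Section GeneratedAlgebra.
Variables (G : monoidType) (n : nat) (X : ringedSpace).
Variable rho : G -> 'M[globsec X]_n.

Definition contains_rep (A : subSheaf (matrix_sheaf X n n)) : Prop :=
  forall (U : opens X) (g : G), subm_set (A U) (rep_res rho U g).

Let in_gen (U : opens X) : set (matrix_sheaf X n n U) :=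
  [set M | forall A : subSheaf (matrix_sheaf X n n),
     is_subalgebra A -> contains_rep A -> subm_set (A U) M].

Let gen_0 U : in_gen (0 : matrix_sheaf X n n U).
Proof. by move=> A _ _; exact: subm_0. Qed.

Let gen_D U (M N : matrix_sheaf X n n U) :
  in_gen M -> in_gen N -> in_gen (M + N).
Proof. by move=> hM hN A hA hr; apply: subm_D; [exact: hM|exact: hN]. Qed.

Let gen_Z U (a : 'O(U)) (M : matrix_sheaf X n n U) :
  in_gen M -> in_gen (a *: M).
Proof. by move=> hM A hA hr; apply: subm_Z; exact: hM. Qed.

Let sec (U : opens X) : submodule (matrix_sheaf X n n U) :=
  Submodule (@gen_0 U) (@gen_D U) (@gen_Z U).

Let sec_res (U V : opens X) (h : V `<=` U) (M : matrix_sheaf X n n U) :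
  subm_set (sec U) M -> subm_set (sec V) (ms_res h M).
Proof. by move=> hM A hA hr; apply: ss_res; exact: hM. Qed.

Let sec_glue (U : opens X) (M : matrix_sheaf X n n U) :
  (forall x, oset U x -> exists (V : opens X) (h : V `<=` U),
      oset V x /\ subm_set (sec V) (ms_res h M)) ->
  subm_set (sec U) M.
Proof.
move=> loc A hA hr; apply: ss_glue => x /loc[V [h [Vx hV]]].
by exists V, h; split=> //; exact: hV.
Qed.

(* O_X[rho(G)], the smallest subsheaf of O_X-algebras containing rho(G). *)
Definition generated_algebra : subSheaf (matrix_sheaf X n n) :=
  SubSheaf sec_res sec_glue.

End GeneratedAlgebra.

Definition is_borel_representation (G : monoidType) (n : nat) (X : ringedSpace)
    (rho : G -> 'M[globsec X]_n) : Prop :=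
  is_representation rho /\ is_borel_mold (generated_algebra rho).

(* (X, rho) represents the functor sending a scheme Y to the set of degree n
   representations with Borel mold of G on Y; that is, X is Rep_n(G)_B and rho is
   the universal representation. *)
Definition is_Rep_B (G : monoidType) (n : nat) (X : scheme)
    (rho : G -> 'M[globsec X]_n) : Prop :=
  is_borel_representation rho /\
  forall (Y : scheme) (sigma : G -> 'M[globsec Y]_n),
    is_borel_representation sigma ->
    exists! f : schemeMor Y X, forall g, map_mx (glob_pull f) (rho g) = sigma g.

Definition is_invariant (G : monoidType) (n : nat) (X : ringedSpace)
    (rho : G -> 'M[globsec X]_n) (L : subSheaf (free_sheaf X n)) : Prop :=
  forall (U : opens X) (g : G) (u : 'cV['O(U)]_n),
    subm_set (L U) u -> subm_set (L U) (rep_res rho U g *m u).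

Definition is_invariant_line_subbundle (G : monoidType) (n : nat)
    (X : ringedSpace) (rho : G -> 'M[globsec X]_n)
    (L : subSheaf (free_sheaf X n)) : Prop :=
  [/\ is_subbundle L, locally_free_of_rank (subsheaf_sheaf L) 1
    & is_invariant rho L].

Definition free_monoid (m : nat) : Type := seq 'I_m.

HB.instance Definition _ (m : nat) := Choice.on (free_monoid m).
HB.instance Definition _ (m : nat) :=
  isMonoid.Build (free_monoid m) (@catA 'I_m) (@cat0s 'I_m) (@cats0 'I_m).

(* Main.v *)
Require Import Defs.
From mathcomp Require Import all_boot all_order all_algebra.
From mathcomp Require Import boolp classical_sets functions topology.
From mathcomp Require Import ring.

(** Let C = [rho(x), rho(y)], with x and y the generators. Locally on X, the
    generated algebra is conjugate to the upper triangular matrices by some P.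
    Being stable under all of them, L is spanned by e = a P e_1, and a is a unit
    because the quotient by L is locally free; C equals z P E_12 P^-1, and z is a
    unit, for otherwise rho(x) and rho(y) would commute in some residue field,
    where they generate the noncommutative algebra of upper triangular matrices.
    Thus C induces an isomorphism O^2/L = L, and O = det(O^2) = L (x) O^2/L
    = L (x) L. Concretely, with J the standard alternating matrix, C J is locally
    a unit multiple of e e^T, and u (x) w is sent to the unique scalar c such that
    u w^T = c C J. *)

Set Implicit Arguments.
Unset Strict Implicit.
Unset Printing Implicit Defensive.

Import GRing.Theory.
Local Open Scope classical_set_scope.
Local Open Scope ring_scope.

(** * Gluing sections of a sheaf of modules *)

Section Gluing.
Variables (X : ringedSpace) (F : modSheaf X).

Lemma ms_res0 (U V : opens X) (h : V `<=` U) : ms_res h (0 : F U) = 0.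
Proof. by apply: (addrI (ms_res h 0)); rewrite -ms_resD !addr0. Qed.

Lemma ms_res_any (U V : opens X) (h h' : V `<=` U) (u : F U) :
  ms_res h u = ms_res h' u.
Proof. by rewrite (Prop_irrelevance h h'). Qed.

Lemma section_eq (U : opens X) (s t : F U) :
  (forall x, oset U x -> exists (V : opens X) (h : V `<=` U),
     oset V x /\ ms_res h s = ms_res h t) ->
  s = t.
Proof.
move=> loc.
pose I := {V : opens X | exists h : V `<=` U, ms_res h s = ms_res h t}.
have WU (k : I) : sval k `<=` U by case: (svalP k).
have cov : U `<=` \bigcup_k sval (k : I).
  by move=> x /loc[V [h [Vx hV]]]; exists (exist _ V (ex_intro _ h hV)).
have [|u [_ uu]] := @ms_sheaf X F U I _ WU cov (fun k => ms_res (WU k) s).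
  move=> k l; have hkl : opensI (sval k) (sval l) `<=` U by move=> ? [/WU].
  by rewrite !(ms_res_comp _ _ hkl).
rewrite -(uu s) // -(uu t) // => k.
by case: (svalP k) => h E; rewrite (ms_res_any _ h) -E (ms_res_any _ (WU k)).
Qed.

(** Local solutions of [Q] may be chosen arbitrarily: restrictions to an overlap still satisfy [Q],
    so uniqueness makes them agree there. Locality of [Q] then passes to the glued section. *)
Lemma glue_unique (U : opens X) (Q : forall V : opens X, F V -> Prop) :
  (forall (V W : opens X) (h : W `<=` V) s, Q V s -> Q W (ms_res h s)) ->
  (forall (V : opens X) s t, V `<=` U -> Q V s -> Q V t -> s = t) ->
  (forall s, (forall x, oset U x -> exists (V : opens X) (h : V `<=` U),
     oset V x /\ Q V (ms_res h s)) -> Q U s) ->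
  (forall x, oset U x -> exists V : opens X,
     [/\ oset V x, V `<=` U & exists s, Q V s]) ->
  exists s, Q U s.
Proof.
move=> Qres Quniq Qloc loc.
pose I := {V : opens X | V `<=` U /\ exists s, Q V s}.
have WU (k : I) : sval k `<=` U by case: (svalP k).
have sec (k : I) : exists s, Q (sval k) s by case: (svalP k).
have cov : U `<=` \bigcup_k sval (k : I).
  by move=> x /loc[V [Vx VU Vs]]; exists (exist _ V (conj VU Vs)).
have [|u [uE _]] := @ms_sheaf X F U I _ WU cov (fun k => projT1 (cid (sec k))).
  move=> k l; apply: (Quniq); first by move=> ? [/WU].
    by apply: Qres; exact: (projT2 (cid (sec k))).
  by apply: Qres; exact: (projT2 (cid (sec l))).
exists u; apply: Qloc => x /loc[V [Vx VU Vs]]; exists V, VU; split=> //.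
pose k : I := exist _ V (conj VU Vs).
by rewrite (ms_res_any _ (WU k)) uE; exact: (projT2 (cid (sec k))).
Qed.

End Gluing.

(** * Tensor products with value the structure sheaf *)

Lemma modMor_eq (X : ringedSpace) (F G : modSheaf X) (f g : modMor F G) :
  (forall U u, f U u = g U u) -> f = g.
Proof.
case: f g => [f fD fZ fn] [g gD gZ gn] /= fg.
have E : f = g by apply: functional_extensionality_dep => U; exact/funext/fg.
by subst g; congr ModMor; exact: Prop_irrelevance.
Qed.

Lemma mod_iso_refl (X : ringedSpace) (F : modSheaf X) : mod_iso F F.
Proof.
pose f : modMor F F := @ModMor X F F (fun _ u => u) (fun _ _ _ => erefl)
  (fun _ _ _ => erefl) (fun _ _ _ _ => erefl).
by exists f, f.
Qed.


(* A pairing into O whose value on local generators is a unit exhibits O as the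
   tensor product: a bilinear b then factors through the section glued from the
   local sections t(e, e')^-1 b(e, e'). *)
Section PerfectPairing.
Variables (X : ringedSpace) (F G : modSheaf X).
Variable t : bilinMor F G (structure_sheaf X).
Hypothesis perfect : forall x : X, exists U : opens X, oset U x /\
  exists (e : F U) (e' : G U),
    [/\ forall (V : opens X) (h : V `<=` U) s, exists c, s = c *: ms_res h e,
        forall (V : opens X) (h : V `<=` U) s, exists c, s = c *: ms_res h e'
      & @is_unit 'O(U) (t U e e')].

Let pairing (U : opens X) (u : F U) (v : G U) : 'O(U) := t U u v.

Let pairingZl (U : opens X) (a : 'O(U)) (u : F U) (v : G U) :
  pairing (a *: u) v = a * pairing u v.
Proof. exact: (bm_funZl t a u v). Qed.

Let pairingZr (U : opens X) (a : 'O(U)) (u : F U) (v : G U) :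
  pairing u (a *: v) = a * pairing u v.
Proof. exact: (bm_funZr t a u v). Qed.

Let pairing_res (U V : opens X) (h : V `<=` U) (u : F U) (v : G U) :
  pairing (ms_res h u) (ms_res h v) = rs_res h (pairing u v).
Proof. exact: (bm_nat t h u v). Qed.

Section Factor.
Variables (H : modSheaf X) (b : bilinMor F G H).

(** A morphism from O to [H] is determined by the image of 1. A factorization of [b] through [t] is
    therefore encoded as a section [s], the image of 1, and existence and uniqueness of the morphism
    become those of [s]. *)
Let factors (V : opens X) (s : H V) : Prop :=
  forall (W : opens X) (k : W `<=` V) (u : F W) (v : G W),
    b W u v = pairing u v *: ms_res k s.

Let factors_res (V W : opens X) (h : W `<=` V) s :
  factors s -> factors (ms_res h s).
Proof.
move=> Qs Z k u v; have kh : Z `<=` V by move=> ? /k/h.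
by rewrite (ms_res_comp _ _ kh); exact: Qs.
Qed.

Let factors_uniq (V : opens X) (s s' : H V) : factors s -> factors s' -> s = s'.
Proof.
move=> Qs Qs'; apply: section_eq => x Vx.
have [U [Ux [e [e' [_ _ [r tr]]]]]] := perfect x.
pose W := opensI V U; have WU : W `<=` U by move=> ? [].
have WV : W `<=` V by move=> ? [].
exists W, WV; split=> //.
have := Qs' _ WV (ms_res WU e) (ms_res WU e'); rewrite (Qs _ WV) pairing_res.
move/(congr1 ( *:%R (rs_res WU r))); rewrite !scalerA -!rmorphM.
by rewrite [r * _]mulrC tr rmorph1 !scale1r.
Qed.

Lemma perfect_factor :
  exists s : H (opensT X), factors s /\ forall s', factors s' -> s' = s.
Proof.
suff [s Qs] : exists s : H (opensT X), factors s.
  by exists s; split=> // s' /factors_uniq; apply.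
apply: (glue_unique factors_res) => [V s s' _|s loc|x _].
- exact: factors_uniq.
- move=> W k u v; apply: section_eq => x Wx.
  have [//|V [h [Vx QV]]] := loc x.
  have hW : opensI W V `<=` W by move=> ? [].
  have hV : opensI W V `<=` V by move=> ? [].
  have hT : opensI W V `<=` opensT X by [].
  exists (opensI W V), hW; split=> //.
  rewrite -bm_nat ms_resZ (QV _ hV) !(ms_res_comp _ _ hT).
  by rewrite pairing_res.
- have [U [Ux [e [e' [eF eG [r tr]]]]]] := perfect x.
  exists U; split=> //; exists (r *: b U e e') => W k u v.
  have [c ->] := eF _ k u; have [d ->] := eG _ k v.
  rewrite bm_funZl bm_funZr bm_nat pairingZl pairingZr pairing_res ms_resZ.
  rewrite !scalerA; congr (_ *: _).
  by rewrite -!mulrA -rmorphM tr rmorph1 mulr1.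
Qed.

End Factor.

Lemma perfect_tensor_product : is_tensor_product t.
Proof.
move=> H b; have [s [Qs s_uniq]] := perfect_factor b.
have UT (U : opens X) : U `<=` opensT X by [].
pose f (U : opens X) (a : 'O(U)) : H U := a *: ms_res (UT U) s.
have fD U (a a' : 'O(U)) : f U (a + a') = f U a + f U a' by exact: scalerDl.
have fZ U (a a' : 'O(U)) : f U (a * a') = a *: f U a' by rewrite /f scalerA.
have fn (U V : opens X) (h : V `<=` U) (a : 'O(U)) :
    f V (rs_res h a) = ms_res h (f U a).
  by rewrite /f ms_resZ (ms_res_comp _ _ (UT V)).
exists (@ModMor X (structure_sheaf X) H f fD fZ fn); split.
  by move=> U u v /=; rewrite /f -(Qs U (UT U)).
move=> g gb; apply: modMor_eq => U a /=; rewrite /f.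
have gE V (a' : structure_sheaf X V) : g V a' = a' *: g V 1.
  by rewrite -mm_funZ /GRing.scale /= mulr1.
rewrite gE -(s_uniq (g (opensT X) 1)).
  by rewrite -mm_nat /= rmorph1.
by move=> W k u v; rewrite -mm_nat /= rmorph1 -gb gE.
Qed.

End PerfectPairing.

(** * Line subsheaves of a free sheaf and their tensor squares *)

Lemma map_res_comp (X : ringedSpace) m n (U V W : opens X)
    (hUV : V `<=` U) (hVW : W `<=` V) (hUW : W `<=` U) (M : 'M['O(U)]_(m, n)) :
  map_mx (rs_res hVW) (map_mx (rs_res hUV) M) = map_mx (rs_res hUW) M.
Proof. exact: (@ms_res_comp X (matrix_sheaf X m n)). Qed.

Lemma map_res_id (X : ringedSpace) m n (U : opens X) (h : U `<=` U)
    (M : 'M['O(U)]_(m, n)) : map_mx (rs_res h) M = M.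
Proof. exact: (@ms_res_id X (matrix_sheaf X m n)). Qed.

(* The restriction of L to U is free of rank one on e. *)
Definition generates (X : ringedSpace) (F : modSheaf X) (L : subSheaf F)
    (U : opens X) (e : F U) : Prop :=
  subm_set (L U) e /\
  forall (V : opens X) (h : V `<=` U),
    (forall s, subm_set (L V) s -> exists c, s = c *: ms_res h e) /\
    (forall c, c *: ms_res h e = 0 -> c = 0).

Lemma generates_res (X : ringedSpace) (F : modSheaf X) (L : subSheaf F)
    (U V : opens X) (h : V `<=` U) (e : F U) :
  generates L e -> generates L (ms_res h e).
Proof.
move=> [Le gen]; split=> [|W k]; first exact: ss_res.
have kh : W `<=` U by move=> ? /k/h.
by rewrite (ms_res_comp _ _ kh); exact: gen.
Qed.

Lemma free_over1_generates (X : ringedSpace) (F : modSheaf X) (L : subSheaf F)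
    (U : opens X) :
  free_over (subsheaf_sheaf L) U 1 -> exists e : F U, generates L e.
Proof.
move=> [e eP]; exists (subm_val (e 0)); split=> [|V h]; first exact: subm_valP.
split=> [s Ls|c c0].
  have [c [cE _]] := eP V h (subm_elt Ls); exists (c 0 0).
  by move/(congr1 (@subm_val _ _ _)): cE; rewrite big_ord1.
(* Both 0 and the row with entry [c] are coordinates of the zero section. *)
have [d [_ d_uniq]] := eP V h 0.
have : d = 0 by apply: d_uniq; rewrite big_ord1 mxE scale0r.
have : d = const_mx c.
  apply: d_uniq; rewrite big_ord1 mxE; apply: subm_val_inj.
  by rewrite -[RHS]/(c *: ms_res h (subm_val (e 0))) c0.
by move=> -> /matrixP/(_ 0 0); rewrite !mxE.
Qed.

Section SymmetricSquare.
Variables (X : ringedSpace) (n : nat) (L : subSheaf (free_sheaf X n)).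
Variable D : 'M[globsec X]_n.

Let res_D (U : opens X) : 'M['O(U)]_n :=
  map_mx (@rs_res X (opensT X) U (@subsetT X U)) D.

Hypothesis loc : forall x : X, exists U : opens X, oset U x /\
  exists (e : 'cV['O(U)]_n) (k : 'O(U)),
    [/\ @generates X (free_sheaf X n) L U e, is_unit k
      & e *m e^T = k *: res_D U].

Let res_res_D (U V : opens X) (h : V `<=` U) :
  map_mx (rs_res h) (res_D U) = res_D V.
Proof. exact: (@map_res_comp X n n (opensT X) U V _ _ (@subsetT X V)). Qed.

Let outer_eq (U : opens X) (M N : 'M['O(U)]_n) :
  (forall x, oset U x -> exists (V : opens X) (h : V `<=` U),
     oset V x /\ map_mx (rs_res h) M = map_mx (rs_res h) N) ->
  M = N.
Proof. exact: (@section_eq X (matrix_sheaf X n n)). Qed.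

Let map_outer (U V : opens X) (h : V `<=` U) (u w : 'cV['O(U)]_n) :
  map_mx (rs_res h) (u *m w^T) = map_mx (rs_res h) u *m (map_mx (rs_res h) w)^T.
Proof. by rewrite map_mxM map_trmx. Qed.

Let scale_D_inj (U : opens X) (a b : 'O(U)) :
  a *: res_D U = b *: res_D U -> a = b.
Proof.
move=> ab; apply: (@section_eq X (structure_sheaf X)) => x Ux /=.
have [V [Vx [e [k [[_ eP] kU eD]]]]] := loc x.
pose W := opensI U V; have WU : W `<=` U by move=> ? [].
have WV : W `<=` V by move=> ? [].
exists W, WU; split=> //; apply/eqP; rewrite -subr_eq0 -rmorphB; apply/eqP.
set c := rs_res WU (a - b).
have c0 : c *: res_D W = 0.
  by rewrite -(res_res_D WU) -map_mxZ scalerBl ab subrr map_mx0.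
pose e' : 'cV['O(W)]_n := map_mx (rs_res WV) e.
have ce0 : c *: (e' *m e'^T) = 0.
  by rewrite -map_outer eD map_mxZ res_res_D scalerA mulrC -scalerA c0 scaler0.
(* Freeness of e is used twice: it reduces c = 0 to c e_j = 0 for every j, and then each of these to
   (c e_j) e = 0, whose entries are entries of c e e^T. *)
have [_ e_reg] := eP W WV; apply: (e_reg).
apply/matrixP => j l; rewrite !ord1 !mxE; apply: (e_reg).
apply/matrixP => i m; rewrite !ord1 !mxE.
move/matrixP: ce0 => /(_ i j); rewrite !mxE big_ord1 !mxE => <-.
by rewrite -[LHS]mulrA [X in _ * X]mulrC.
Qed.

(** Where e generates L, u = c e and w = d e, so u w^T = c d e e^T = c d k D. By [scale_D_inj] these
    local coefficients are unique, hence they glue. *)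
Let coefP (U : opens X) (u w : 'cV['O(U)]_n) :
  subm_set (L U) u -> subm_set (L U) w ->
  exists a : 'O(U), u *m w^T = a *: res_D U.
Proof.
move=> Lu Lw.
(* Here V is an arbitrary open set while u and w live over U, so the equation is imposed on every W
   contained in both. *)
pose Q (V : opens X) (a : structure_sheaf X V) :=
  forall (W : opens X) (h : W `<=` U) (k : W `<=` V),
    map_mx (rs_res h) (u *m w^T) = rs_res k a *: res_D W.
have [a Qa] : exists a, @Q U a.
  apply: (@glue_unique X (structure_sheaf X)).
  - move=> V W h a Qa Z hU hW; have hV : Z `<=` V by move=> ? /hW/h.
    by rewrite (Qa _ hU hV) /= (rs_res_comp _ _ hV).
  - move=> V a b VU Qa Qb; apply: scale_D_inj.
    by have := Qb _ VU (fun _ => id); rewrite (Qa _ _ (fun _ => id)) !rs_res_id.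
  - move=> a aloc V h k; apply: outer_eq => x Vx.
    have [|W [hW [Wx QW]]] := aloc x; first exact: h.
    have ZV : opensI V W `<=` V by move=> ? [].
    have ZW : opensI V W `<=` W by move=> ? [].
    have ZU : opensI V W `<=` U by move=> ? [/h].
    exists (opensI V W), ZV; split=> //.
    have := QW _ ZU ZW; rewrite /= (rs_res_comp _ _ ZU) map_mxZ res_res_D.
    rewrite (rs_res_comp _ _ ZU) => <-.
    exact: map_res_comp.
  - move=> x Ux; have [V [Vx [e [k [[_ eP] kU eD]]]]] := loc x.
    pose W := opensI U V; have WU : W `<=` U by move=> ? [].
    have WV : W `<=` V by move=> ? [].
    have [eG _] := eP W WV.
    have [c cE] := eG _ (ss_res WU Lu); have [d dE] := eG _ (ss_res WU Lw).
    exists W; split=> //; exists (c * d * rs_res WV k : 'O(W)) => Z h m.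
    have -> : map_mx (rs_res h) (u *m w^T) =
        map_mx (rs_res m) (map_mx (rs_res WU) (u *m w^T)).
      by rewrite (map_res_comp _ _ h).
    rewrite map_outer [map_mx _ u]cE [map_mx _ w]dE.
    rewrite -(res_res_D m) -map_mxZ; congr (map_mx _ _).
    by rewrite linearZ /= -scalemxAl -scalemxAr -map_outer eD map_mxZ res_res_D
      !scalerA.
exists a; have := Qa U (fun _ => id) (fun _ => id).
by rewrite rs_res_id => <-; rewrite map_res_id.
Qed.

Let coef (U : opens X) (u w : subm_type (L U)) : 'O(U) :=
  projT1 (cid (coefP (subm_valP u) (subm_valP w))).

Let coefE (U : opens X) (u w : subm_type (L U)) :
  (subm_val u : 'cV_n) *m (subm_val w : 'cV_n)^T = coef u w *: res_D U.
Proof. exact: (projT2 (cid (coefP (subm_valP u) (subm_valP w)))). Qed.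

Let coefDl U (u u' w : subm_type (L U)) :
  coef (u + u') w = coef u w + coef u' w.
Proof. by apply: scale_D_inj; rewrite scalerDl -!coefE -mulmxDl. Qed.

Let coefDr U (u w w' : subm_type (L U)) :
  coef u (w + w') = coef u w + coef u w'.
Proof. by apply: scale_D_inj; rewrite scalerDl -!coefE -mulmxDr -linearD. Qed.

Let coefZl U a (u w : subm_type (L U)) : coef (a *: u) w = a * coef u w.
Proof. by apply: scale_D_inj; rewrite -scalerA -!coefE scalemxAl. Qed.

Let coefZr U a (u w : subm_type (L U)) : coef u (a *: w) = a * coef u w.
Proof.
by apply: scale_D_inj; rewrite -scalerA -!coefE scalemxAr -linearZ.
Qed.

Let coef_res (U V : opens X) (h : V `<=` U) (u w : subsheaf_sheaf L U) :
  coef (ms_res h u) (ms_res h w) = rs_res h (coef u w).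
Proof.
by apply: scale_D_inj; rewrite -coefE -(res_res_D h) -map_mxZ -coefE map_outer.
Qed.

(** The map sending u (x) w to u w^T takes values in the multiples of D, and the coordinate along D
    is a pairing of L with itself. Its value on (e, e) is the unit k, so the pairing is perfect and
    O is the tensor square. *)
Lemma symmetric_square_trivial :
  exists (L2 : modSheaf X)
         (t : bilinMor (subsheaf_sheaf L) (subsheaf_sheaf L) L2),
    is_tensor_product t /\ mod_iso L2 (structure_sheaf X).
Proof.
exists (structure_sheaf X).
exists (@BilinMor X (subsheaf_sheaf L) (subsheaf_sheaf L) (structure_sheaf X)
  coef coefDl coefDr coefZl coefZr coef_res).
split; last exact: mod_iso_refl.
apply: perfect_tensor_product => x.
have [U [Ux [e [k [[Le eP] kU eD]]]]] := loc x.
exists U; split=> //; pose e' : subm_type (L U) := subm_elt Le.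
have gen (V : opens X) (h : V `<=` U) (s : subsheaf_sheaf L V) :
    exists c, s = c *: (ms_res h (e' : subsheaf_sheaf L U)).
  have [c cE] := (eP V h).1 _ (subm_valP s); exists c.
  exact: subm_val_inj.
exists e', e'; split=> //=.
suff -> : coef e' e' = k by [].
by apply: scale_D_inj; rewrite -coefE.
Qed.

End SymmetricSquare.

(** * Units in a stalk and vanishing in the residue field *)

Section Germs.
Variables (X : ringedSpace) (x : X).

Lemma is_unit_rmorph (R S : comPzRingType) (f : {rmorphism R -> S}) (r : R) :
  is_unit r -> is_unit (f r).
Proof. by move=> [r' rr']; exists (f r'); rewrite -rmorphM rr' rmorph1. Qed.

Lemma is_unitM (R : comPzRingType) (r s : R) :
  is_unit r -> is_unit s -> is_unit (r * s).
Proof.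
by move=> [r' rr'] [s' ss']; exists (r' * s'); rewrite mulrACA rr' ss' mulr1.
Qed.

Lemma germ_unit_res (U V : opens X) (h : V `<=` U) (s : 'O(U)) :
  oset V x -> germ_unit x (rs_res h s) <-> germ_unit x s.
Proof.
move=> Vx; split=> [[W [k [Wx sW]]]|[W [k [Wx sW]]]].
  have kh : W `<=` U by move=> ? /k/h.
  by exists W, kh; split=> //; rewrite -(rs_res_comp h k).
have lV : opensI V W `<=` V by move=> ? [].
have lW : opensI V W `<=` W by move=> ? [].
have lU : opensI V W `<=` U by move=> ? [/h].
exists (opensI V W), lV; split=> //.
by rewrite (rs_res_comp _ _ lU) -(rs_res_comp k lW); exact: is_unit_rmorph.
Qed.

Lemma germ_unit_mull (U : opens X) (s t : 'O(U)) :
  germ_unit x (s * t) -> germ_unit x s.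
Proof.
move=> [V [h [Vx [r rst]]]]; exists V, h; split=> //.
by exists (rs_res h t * r); rewrite mulrA -rmorphM.
Qed.

Lemma germ_unit_mulr (U : opens X) (s t : 'O(U)) :
  germ_unit x (s * t) -> germ_unit x t.
Proof. by rewrite mulrC; exact: germ_unit_mull. Qed.

Hypothesis loc : stalk_local x.

Lemma germ_unit0 (U : opens X) : oset U x -> ~ germ_unit x (0 : 'O(U)).
Proof.
move=> Ux [V [h [Vx [r]]]]; rewrite rmorph0 mul0r => /esym.
by have [+ _] := loc Vx.
Qed.

Lemma germ_unit1 (U : opens X) : oset U x -> germ_unit x (1 : 'O(U)).
Proof.
move=> Ux; exists U, (fun _ => id); split=> //.
by exists 1; rewrite rmorph1 mulr1.
Qed.

(** Once (s + t) r = 1 near x, t r = 1 - s r, and locality of the stalk makes s r or 1 - s r a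
    unit. *)
Lemma germ_unitD (U : opens X) (s t : 'O(U)) :
  germ_unit x (s + t) -> germ_unit x s \/ germ_unit x t.
Proof.
move=> [V [h [Vx [r rst]]]].
have [_ /(_ (rs_res h s * r))[/germ_unit_mull|]] := loc Vx.
  by rewrite germ_unit_res //; left.
rewrite -rst rmorphD mulrDl addrAC subrr add0r => /germ_unit_mull.
by rewrite germ_unit_res //; right.
Qed.

Lemma germ_unit_sum (U : opens X) r (s : 'I_r -> 'O(U)) :
  oset U x -> germ_unit x (\sum_i s i) -> exists i, germ_unit x (s i).
Proof.
move=> Ux; elim: r s => [|r IH] s; first by rewrite big_ord0 => /germ_unit0[].
rewrite big_ord_recl => /germ_unitD[u|/IH[i u]]; first by exists ord0.
by exists (lift ord0 i).
Qed.

(* The entries of M vanish in the residue field at x. *)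
Definition vanishes (U : opens X) m n (M : 'M['O(U)]_(m, n)) : Prop :=
  forall i j, ~ germ_unit x (M i j).

Lemma vanishesD (U : opens X) m n (M N : 'M['O(U)]_(m, n)) :
  vanishes M -> vanishes N -> vanishes (M + N).
Proof. by move=> vM vN i j; rewrite mxE => /germ_unitD[/vM|/vN]. Qed.

Lemma vanishesZ (U : opens X) m n a (M : 'M['O(U)]_(m, n)) :
  vanishes M -> vanishes (a *: M).
Proof. by move=> vM i j; rewrite mxE => /germ_unit_mulr/vM. Qed.

Lemma vanishes0 (U : opens X) m n : oset U x -> vanishes (0 : 'M['O(U)]_(m, n)).
Proof. by move=> Ux i j; rewrite mxE; exact: germ_unit0. Qed.

Lemma vanishesMl (U : opens X) m n p (M : 'M['O(U)]_(m, n))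
    (N : 'M['O(U)]_(n, p)) : oset U x -> vanishes N -> vanishes (M *m N).
Proof.
by move=> Ux vN i j; rewrite mxE => /(germ_unit_sum Ux)[k /germ_unit_mulr/vN].
Qed.

Lemma vanishesMr (U : opens X) m n p (M : 'M['O(U)]_(m, n))
    (N : 'M['O(U)]_(n, p)) : oset U x -> vanishes M -> vanishes (M *m N).
Proof.
by move=> Ux vM i j; rewrite mxE => /(germ_unit_sum Ux)[k /germ_unit_mull/vM].
Qed.

Lemma vanishes_res (U V : opens X) (h : V `<=` U) m n (M : 'M['O(U)]_(m, n)) :
  oset V x -> vanishes (map_mx (rs_res h) M) <-> vanishes M.
Proof.
by move=> Vx; split=> vM i j; move: (vM i j); rewrite mxE germ_unit_res.
Qed.

End Germs.

(** * Commutators and the algebra generated by a representation *)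

Definition commutator (R : pzRingType) n (M N : 'M[R]_n) : 'M[R]_n :=
  M *m N - N *m M.

Lemma commutator_skew (R : pzRingType) n (M N : 'M[R]_n) :
  commutator M N = - commutator N M.
Proof. by rewrite /commutator opprB. Qed.

(** The Leibniz rule; it makes the matrices commuting with N in a residue field closed under
    products. *)
Lemma commutatorMl (R : pzRingType) n (M M' N : 'M[R]_n) :
  commutator (M *m M') N = M *m commutator M' N + commutator M N *m M'.
Proof.
by rewrite /commutator mulmxBr mulmxBl !mulmxA addrA addrNK.
Qed.

Lemma map_commutator (R S : pzRingType) (f : {rmorphism R -> S}) n
    (M N : 'M[R]_n) :
  map_mx f (commutator M N) = commutator (map_mx f M) (map_mx f N).
Proof. by rewrite /commutator map_mxB !map_mxM. Qed.

Section GeneratedAlgebraProperties.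
Variables (m n : nat) (X : ringedSpace).
Variable rho : free_monoid m -> 'M[globsec X]_n.
Hypothesis rho_rep : is_representation rho.

(* The matrices commuting with N in the residue field at x form a sheaf of
   subalgebras over all of X, with no condition on open sets missing x. *)
Section CommutantAt.
Variables (x : X) (loc : stalk_local x).
Variables (U : opens X) (N : 'M['O(U)]_n).

Let sec_set (V : opens X) : set 'M['O(V)]_n :=
  [set M | forall (W : opens X) (h : W `<=` V) (k : W `<=` U), oset W x ->
    vanishes x (commutator (map_mx (rs_res h) M) (map_mx (rs_res k) N))].

Let sec_0 (V : opens X) : sec_set (0 : 'M['O(V)]_n).
Proof.
move=> W h k Wx; rewrite map_mx0 /commutator mul0mx mulmx0 subrr.
exact: vanishes0.
Qed.

Let sec_D (V : opens X) (M M' : 'M['O(V)]_n) :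
  sec_set M -> sec_set M' -> sec_set (M + M').
Proof.
move=> cM cM' W h k Wx; rewrite map_mxD /commutator mulmxDl mulmxDr.
rewrite opprD addrACA.
by apply: vanishesD => //; [exact: cM|exact: cM'].
Qed.

Let sec_Z (V : opens X) (a : 'O(V)) (M : 'M['O(V)]_n) :
  sec_set M -> sec_set (a *: M).
Proof.
move=> cM W h k Wx; rewrite map_mxZ /commutator -scalemxAl -scalemxAr -scalerBr.
by apply: vanishesZ; exact: cM.
Qed.

Let sec (V : opens X) : submodule (matrix_sheaf X n n V) :=
  Submodule (M := 'M['O(V)]_n) (@sec_0 V) (@sec_D V) (@sec_Z V).

Let sec_res (V W : opens X) (h : W `<=` V) (M : matrix_sheaf X n n V) :
  subm_set (sec V) M -> subm_set (sec W) (ms_res h M).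
Proof.
move=> cM Z hZ k Zx; have hV : Z `<=` V by move=> ? /hZ/h.
by rewrite (map_res_comp _ _ hV); exact: cM.
Qed.

Let sec_glue (V : opens X) (M : matrix_sheaf X n n V) :
  (forall y, oset V y -> exists (W : opens X) (h : W `<=` V),
      oset W y /\ subm_set (sec W) (ms_res h M)) ->
  subm_set (sec V) M.
Proof.
move=> Mloc W h k Wx; have [|Z [hZ [Zx cM]]] := Mloc x; first exact: h.
have lW : opensI W Z `<=` W by move=> ? [].
have lZ : opensI W Z `<=` Z by move=> ? [].
have lU : opensI W Z `<=` U by move=> ? [/k].
have lV : opensI W Z `<=` V by move=> ? [/h].
apply/(@vanishes_res X x _ _ lW) => //; rewrite map_commutator.
rewrite (map_res_comp _ _ lU) (map_res_comp _ _ lV) -(map_res_comp hZ lZ).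
exact: cM.
Qed.

Let commutant : subSheaf (matrix_sheaf X n n) :=
  @SubSheaf X (matrix_sheaf X n n) sec sec_res sec_glue.

Let commutant_subalgebra : is_subalgebra commutant.
Proof.
move=> V; split=> [W h k Wx|M M' cM cM' W h k Wx].
  by rewrite map_mx1 /commutator mul1mx mulmx1 subrr; exact: vanishes0.
rewrite map_mxM commutatorMl; apply: vanishesD => //.
  by apply: vanishesMl => //; exact: cM'.
by apply: vanishesMr => //; exact: cM.
Qed.

(** The commutant is a sheaf of subalgebras. It contains the generators, hence by induction on words
    the whole image of [rho], and so the generated algebra by minimality. *)
Lemma generated_commutes :
  oset U x ->
  (forall i, vanishes x (commutator (rep_res rho U [:: i]) N)) ->
  forall M : 'M['O(U)]_n, subm_set (generated_algebra rho U) M ->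
    vanishes x (commutator M N).
Proof.
move=> Ux cN M /(_ commutant commutant_subalgebra).
(* Writing M and N as their restrictions along the identity turns the goal into membership of M in
   the commutant, tested on U itself. *)
have Mid : map_mx (rs_res (fun _ => id : oset U _ -> oset U _)) M = M.
  exact: map_res_id.
have Nid : map_mx (rs_res (fun _ => id : oset U _ -> oset U _)) N = N.
  exact: map_res_id.
rewrite -[M in vanishes _ (commutator M _)]Mid -Nid; apply=> // V w.
have rep_nil : rep_res rho V [::] = 1%:M.
  by rewrite /rep_res (rho_rep.1 : rho [::] = _) map_mx1.
have rep_cons i v :
      rep_res rho V (i :: v) = rep_res rho V [:: i] *m rep_res rho V v.
  rewrite /rep_res -map_mxM; congr map_mx.
  exact: (rho_rep.2 [:: i] v).
elim: w => [|i w IH]; first (rewrite rep_nil;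
  exact: (commutant_subalgebra V).1).
rewrite rep_cons; apply: (commutant_subalgebra V).2 => //.
move=> W h k Wx; have := cN i.
rewrite -(@vanishes_res X x _ _ k) // map_commutator /rep_res.
by rewrite !(@map_res_comp X n n (opensT X) _ _ _ _ (@subsetT X W)).
Qed.

End CommutantAt.

(* If the generators commute in the residue field at x, then each of them commutes
   with the generated algebra, hence so do any two elements of the latter. *)
Lemma generated_commutative (x : X) (loc : stalk_local x) (U : opens X) :
  oset U x ->
  (forall i j, vanishes x
    (commutator (rep_res rho U [:: i]) (rep_res rho U [:: j]))) ->
  forall M N : 'M['O(U)]_n, subm_set (generated_algebra rho U) M ->
    subm_set (generated_algebra rho U) N -> vanishes x (commutator M N).
Proof.
move=> Ux cAB M N gM gN; apply: generated_commutes => // i.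
move=> k l; rewrite commutator_skew mxE => u.
have v : vanishes x (commutator N (rep_res rho U [:: i])).
  by apply: generated_commutes.
apply: (v k l); have := u; rewrite -mulN1r; exact: germ_unit_mulr.
Qed.

Section Invariant.
Variable L : subSheaf (free_sheaf X n).
Hypothesis L_inv : is_invariant rho L.

Let sec_set (U : opens X) : set 'M['O(U)]_n :=
  [set M | forall (V : opens X) (h : V `<=` U) (u : 'cV['O(V)]_n),
    subm_set (L V) u -> subm_set (L V) (map_mx (rs_res h) M *m u)].

Let sec_0 (U : opens X) : sec_set (0 : 'M['O(U)]_n).
Proof. by move=> V h u Lu; rewrite map_mx0 mul0mx; exact: subm_0. Qed.

Let sec_D (U : opens X) (M N : 'M['O(U)]_n) :
  sec_set M -> sec_set N -> sec_set (M + N).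
Proof.
move=> LM LN V h u Lu; rewrite map_mxD mulmxDl.
by apply: (@subm_D _ _ (L V)); [exact: LM|exact: LN].
Qed.

Let sec_Z (U : opens X) (a : 'O(U)) (M : 'M['O(U)]_n) :
  sec_set M -> sec_set (a *: M).
Proof.
move=> LM V h u Lu; rewrite map_mxZ -scalemxAl.
by apply: (@subm_Z _ _ (L V)); exact: LM.
Qed.

Let sec (U : opens X) : submodule (matrix_sheaf X n n U) :=
  Submodule (M := 'M['O(U)]_n) (@sec_0 U) (@sec_D U) (@sec_Z U).

Let sec_res (U V : opens X) (h : V `<=` U) (M : matrix_sheaf X n n U) :
  subm_set (sec U) M -> subm_set (sec V) (ms_res h M).
Proof.
move=> LM W k u Lu; have kh : W `<=` U by move=> ? /k/h.
by rewrite (map_res_comp _ _ kh); exact: LM.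
Qed.

Let sec_glue (U : opens X) (M : matrix_sheaf X n n U) :
  (forall x, oset U x -> exists (V : opens X) (h : V `<=` U),
      oset V x /\ subm_set (sec V) (ms_res h M)) ->
  subm_set (sec U) M.
Proof.
move=> Mloc V h u Lu; apply: (@ss_glue _ _ L) => x Vx.
have [|W [hW [Wx LM]]] := Mloc x; first exact: h.
have lV : opensI V W `<=` V by move=> ? [].
have lW : opensI V W `<=` W by move=> ? [].
have lU : opensI V W `<=` U by move=> ? [/h].
exists (opensI V W), lV; split=> //=.
rewrite map_mxM (map_res_comp _ _ lU) -(map_res_comp hW lW).
by apply: LM; exact: (@ss_res _ _ L _ _ lV).
Qed.

(** The matrices all of whose restrictions stabilize L form a sheaf of subalgebras containing the
    image of [rho], so minimality applies again. *)
Lemma generated_invariant (U : opens X) (M : 'M['O(U)]_n) (u : 'cV['O(U)]_n) :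
  subm_set (generated_algebra rho U) M -> subm_set (L U) u ->
  subm_set (L U) (M *m u).
Proof.
pose A := @SubSheaf X (matrix_sheaf X n n) sec sec_res sec_glue.
have Aalg : is_subalgebra A.
  move=> V; split=> [W h v|P Q LP LQ W h v Lv]; first by rewrite map_mx1 mul1mx.
  by rewrite map_mxM -mulmxA; apply: LP; exact: LQ.
have Arep : contains_rep rho A.
  move=> V g W h v Lv; rewrite /rep_res.
  rewrite (@map_res_comp X n n (opensT X) _ _ _ _ (@subsetT X W)).
  exact: L_inv.
move=> /(_ A Aalg Arep) /(_ U (fun _ => id) u); rewrite map_res_id; exact.
Qed.

End Invariant.

End GeneratedAlgebraProperties.

(** * Local splitting of a locally free quotient *)

Section Quotient.
Variables (X : ringedSpace) (F : modSheaf X) (A : subSheaf F).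

(** Local surjectivity lifts one section at a time; finitely many neighbourhoods of x are
    intersected by induction on r. *)
Lemma quotient_lift (Q : modSheaf X) (pi : modMor F Q) (x : X) (U : opens X) r
    (q : 'I_r -> Q U) :
  is_quotient A pi -> oset U x ->
  exists (V : opens X) (h : V `<=` U), oset V x /\
    exists u : 'I_r -> F V, forall i, pi V (u i) = ms_res h (q i).
Proof.
move=> [_ lift] Ux; elim: r q => [|r IH] q.
  by exists U, (fun _ => id); split=> //; exists (fun=> 0); case.
have [V [hV [Vx [u uq]]]] := IH (fun i => q (fintype.lift ord0 i)).
have [W [hW [Wx [v vq]]]] := lift U (q ord0) x Ux.
have lV : opensI V W `<=` V by move=> ? [].
have lW : opensI V W `<=` W by move=> ? [].
have lU : opensI V W `<=` U by move=> ? [/hV].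
exists (opensI V W), lU; split=> //.
exists (fun i => if unlift ord0 i is Some j then ms_res lV (u j)
                 else ms_res lW v) => i.
case: unliftP => [j ->|->]; rewrite mm_nat ?uq ?vq.
  exact: ms_res_comp.
exact: ms_res_comp.
Qed.

(* The projection onto the quotient splits locally, so f is g plus a section of a
   complement of A, and the latter is killed by a. *)
Lemma locally_free_quotient_scale (x : X) (U : opens X) (a : 'O(U)) (f : F U) :
  locally_free_quotient A -> oset U x -> subm_set (A U) (a *: f) ->
  exists (V : opens X) (h : V `<=` U), oset V x /\
    exists g : F V, subm_set (A V) g /\ ms_res h (a *: f) = rs_res h a *: g.
Proof.
move=> [Q [pi [piQ Qfree]]] Ux Aaf.
have [V0 V0x [r [q qfree]]] := Qfree x.
have [V1 [h1 [V1x [u uq]]]] := quotient_lift q piQ V0x.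
have lV : opensI U V1 `<=` V1 by move=> ? [].
have lU : opensI U V1 `<=` U by move=> ? [].
have l0 : opensI U V1 `<=` V0 by move=> ? [_ /h1].
set V := opensI U V1 in lV lU l0 *.
(* The row c gives the coordinates of pi(f) in the basis q, and [lin] is the section of pi sending
   each q_i to its lift u_i. Thus f - lin c is the component of f in A. *)
have [c [cE _]] := qfree V l0 (pi V (ms_res lU f)).
pose lin (d : 'rV['O(V)]_r) := \sum_i d 0 i *: ms_res lV (u i).
have pi_lin d : pi V (lin d) = \sum_i d 0 i *: ms_res l0 (q i).
  have pi0 : pi V 0 = 0 by rewrite -(scale0r (0 : F V)) mm_funZ scale0r.
  rewrite (big_morph _ (@mm_funD _ _ _ pi V) pi0); apply: eq_bigr => i _.
  by rewrite mm_funZ mm_nat uq (ms_res_comp _ _ l0).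
exists V, lU; split=> //; exists (ms_res lU f - lin c); split.
  apply/piQ.1; rewrite -scaleN1r mm_funD mm_funZ pi_lin cE scaleN1r.
  exact: subrr.
(* As a f lies in A, the row a c gives the coordinates of pi(a f) = 0 in a free module. *)
have ac0 : rs_res lU a *: c = 0.
  have [d [_ d_uniq]] := qfree V l0 0.
  have <- : d = 0.
    by apply: d_uniq; rewrite big1 // => i _; rewrite mxE scale0r.
  apply/esym/d_uniq; rewrite -pi_lin.
  have -> : lin (rs_res lU a *: c) = rs_res lU a *: lin c.
    by rewrite /lin scaler_sumr; apply: eq_bigr => i _; rewrite mxE scalerA.
  rewrite mm_funZ pi_lin -cE -mm_funZ -ms_resZ.
  by apply/esym/piQ.1; exact: ss_res.
rewrite scalerBr -ms_resZ; have -> : rs_res lU a *: lin c = 0.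
  rewrite /lin scaler_sumr big1 // => i _; rewrite scalerA.
  by move/matrixP: ac0 => /(_ 0 i); rewrite !mxE => ->; rewrite scale0r.
by rewrite subr0.
Qed.

End Quotient.

(** * Two-by-two matrices and the alternating form *)

Lemma ord2P (k : 'I_2) : k = 0 \/ k = 1.
Proof. by case: k => [[|[|//]] lt]; [left|right]; exact: val_inj. Qed.

Section TwoByTwo.
Variable R : comPzRingType.

Lemma matrix2P (M N : 'M[R]_2) :
  M 0 0 = N 0 0 -> M 0 1 = N 0 1 -> M 1 0 = N 1 0 -> M 1 1 = N 1 1 -> M = N.
Proof.
move=> e00 e01 e10 e11; apply/matrixP => i j.
by case: (ord2P i) (ord2P j) => -> [] ->.
Qed.

(** The alternating matrix J, with the sign for which E_12 J = E_11. *)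
Definition sympl : 'M[R]_2 := delta_mx 1 0 - delta_mx 0 1.

Let det2 (M : 'M[R]_2) : R := M 0 0 * M 1 1 - M 0 1 * M 1 0.

Lemma mul2E m p (M : 'M[R]_(m, 2)) (N : 'M[R]_(2, p)) i j :
  (M *m N) i j = M i 0 * N 0 j + M i 1 * N 1 j.
Proof.
rewrite mxE !big_ord_recl big_ord0 addr0.
by congr (_ + M i _ * N _ j); exact: val_inj.
Qed.

(** The scalar is det M, by which M acts on the rank one module of alternating matrices. *)
Lemma mul_sympl (M : 'M[R]_2) : exists d, M *m sympl *m M^T = d *: sympl.
Proof.
exists (det2 M).
by apply: matrix2P; rewrite !(mul2E, mxE) /= /det2; ring.
Qed.

End TwoByTwo.

(** * Local comparison of the line bundle with the commutator of the generators *)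

Section LocalFrame.
Variables (X : scheme) (rho : free_monoid 2 -> 'M[globsec X]_2).
Hypothesis rho_borel : is_borel_representation rho.
Variable L : subSheaf (free_sheaf X 2).
Hypothesis L_inv : is_invariant_line_subbundle rho L.

Let rho_rep : is_representation rho := rho_borel.1.

(** The last two clauses express the two inclusions between the generated algebra and the conjugate
    by P of the upper triangular matrices, the second one tested on the image of [rho]. *)
Let adapted (U : opens X) (e : 'cV['O(U)]_2) (P P' : 'M['O(U)]_2) : Prop :=
  [/\ @generates X (free_sheaf X 2) L U e, P *m P' = 1%:M, P' *m P = 1%:M,
      forall T : 'M['O(U)]_2, upper_triangular T ->
        subm_set (generated_algebra rho U) (P *m T *m P')
    & forall g, exists2 T : 'M['O(U)]_2, upper_triangular T &
        rep_res rho U g = P *m T *m P'].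

Let adapted_at (x : X) : exists2 U : opens X, oset U x &
  exists e P P', @adapted U e P P'.
Proof.
have [_ L1 _] := L_inv; have [U1 U1x /free_over1_generates[e eP]] := L1 x.
have [U0 U0x [P [P' [PP' P'P conj]]]] := rho_borel.2.2 x.
pose U := opensI U0 U1; have h0 : U `<=` U0 by move=> ? [].
have h1 : U `<=` U1 by move=> ? [].
exists U => //; exists (ms_res h1 e).
exists (map_mx (rs_res h0) P), (map_mx (rs_res h0) P').
have := conj U h0; set p := map_mx _ P; set p' := map_mx _ P'.
have pp' : p *m p' = 1%:M by rewrite -map_mxM PP' map_mx1.
have p'p : p' *m p = 1%:M by rewrite -map_mxM P'P map_mx1.
move=> conjU; split=> //; first exact: generates_res.
  move=> T Tup; have : subm_set (upper_sheaf X 2 U) T by [].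
  rewrite -conjU => -[M gM <-].
  by rewrite !mulmxA pp' mul1mx -mulmxA pp' mulmx1.
move=> g; exists (p' *m rep_res rho U g *m p).
  have : subm_set (upper_sheaf X 2 U) (p' *m rep_res rho U g *m p); last by [].
  by rewrite -conjU; exists (rep_res rho U g) => // A _; exact.
by rewrite !mulmxA pp' mul1mx -mulmxA pp' mulmx1.
Qed.

Section Adapted.
Variables (x : X) (U : opens X) (e : 'cV['O(U)]_2) (P P' : 'M['O(U)]_2).
Hypotheses (Ux : oset U x) (ad : adapted e P P').

Let PP' : P *m P' = 1%:M. Proof. by case: ad. Qed.
Let P'P : P' *m P = 1%:M. Proof. by case: ad. Qed.
Let gen_e : @generates X (free_sheaf X 2) L U e. Proof. by case: ad. Qed.

Let e_reg (c : 'O(U)) : c *: e = 0 -> c = 0.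
Proof.
by case: gen_e => _ /(_ U (fun _ => id))[_] /(_ c); rewrite ms_res_id.
Qed.

Let conjK (M N : 'M['O(U)]_2) :
  (P *m M *m P') *m (P *m N *m P') = P *m (M *m N) *m P'.
Proof. by rewrite !mulmxA -(mulmxA _ P' P) P'P mulmx1. Qed.

Let unit_upper (i j : 'I_2) : (i <= j)%N ->
  upper_triangular (delta_mx i j : 'M['O(U)]_2).
Proof.
move=> ij k l lk; rewrite mxE; case: eqP => //= ki; case: eqP => //= lj.
by move: lk; rewrite ki lj ltnNge ij.
Qed.

(** In the frame P the generator becomes v = P^-1 e. Since L has rank one and is stable under the
    generated algebra, v is a common eigenvector of all upper triangular matrices. Scalars cancel
    against v, so the relations between matrix units pass to their eigenvalues. *)
Let frame_direction : exists a : 'O(U), e = a *: (P *m delta_mx 0 0).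
Proof.
have [_ _ _ gT _] := ad; have [Le /(_ U (fun _ => id))[eG _]] := gen_e.
pose v : 'cV['O(U)]_2 := P' *m e.
have scal T : upper_triangular T -> exists s, T *m v = s *: v.
  move=> /gT gPT; case: (L_inv) => _ _ L_stab.
  have [s] := eG _ (generated_invariant L_stab gPT Le).
  rewrite ms_res_id => /(congr1 (mulmx P')); rewrite !mulmxA P'P mul1mx => sE.
  by exists s; rewrite sE -scalemxAr.
have v_reg c : c *: v = 0 -> c = 0.
  move=> /(congr1 (mulmx P)); rewrite mulmx0 -scalemxAr mulmxA PP' mul1mx.
  exact: e_reg.
have v_inj c d : c *: v = d *: v -> c = d.
  move/eqP; rewrite -subr_eq0 -scalerBl => /eqP/v_reg/eqP.
  by rewrite subr_eq0 => /eqP.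
(* Write E_ij v = s_ij v. As s_12 = s_11 s_12 = s_12 s_22 and s_11 s_22 = 0,
   s_12 = 0, that is, the second entry of v vanishes. *)
have [s1 s1E] := scal _ (@unit_upper 0 0 isT).
have [s2 s2E] := scal _ (@unit_upper 1 1 isT).
have [s sE] := scal _ (@unit_upper 0 1 isT).
have mulE c d (M N : 'M['O(U)]_2) : M *m v = c *: v -> N *m v = d *: v ->
    M *m N *m v = (c * d) *: v.
  by move=> Mv Nv; rewrite -mulmxA Nv -scalemxAr Mv scalerA mulrC.
have s12 : s1 * s2 = 0.
  apply: v_reg; rewrite -(mulE _ _ _ _ s1E s2E) mul_delta_mx_cond.
  by rewrite mulr0n mul0mx.
have ss1 : s1 * s = s.
  by apply: v_inj; rewrite -(mulE _ _ _ _ s1E sE) mul_delta_mx.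
have ss2 : s * s2 = s.
  by apply: v_inj; rewrite -(mulE _ _ _ _ sE s2E) mul_delta_mx.
have s0 : s = 0 by rewrite -ss2 -ss1 mulrAC s12 mul0r.
have v1 : v 1 0 = 0.
  move: sE; rewrite s0 scale0r => /matrixP/(_ 0 0).
  by rewrite mul2E [RHS]mxE ![delta_mx _ _ _ _]mxE /= mul0r mul1r add0r.
exists (v 0 0); rewrite scalemxAr -[LHS]mul1mx -PP' -mulmxA; congr (_ *m _).
rewrite -/v; apply/matrixP => i j; rewrite ord1 [RHS]mxE [X in _ * X]mxE.
have [->|->] := ord2P i; first by rewrite mulr1.
by rewrite v1 mulr0.
Qed.

(** Local splitting of the quotient replaces P e_1 by a section g of L with e = a g near x. Writing
    g = c e gives e = a c e, and freeness of e yields a c = 1. *)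
Let frame_unit (a : 'O(U)) : e = a *: (P *m delta_mx 0 0) -> germ_unit x a.
Proof.
move=> ea; have [Le eG] := gen_e.
have [[_ Lquot] _ _] := L_inv.
have Laf : subm_set (L U) (a *: (P *m delta_mx 0 0 : 'cV_2)) by rewrite -ea.
have [V [h [Vx [g [Lg agE]]]]] := locally_free_quotient_scale Lquot Ux Laf.
have [/(_ _ Lg)[c gE] V_reg] := eG V h.
exists V, h; split=> //; exists c; apply/eqP; rewrite eq_sym -subr_eq0.
apply/eqP/V_reg; rewrite scalerBl scale1r -scalerA -gE -agE -ea subrr //.
Qed.

Let commutator_upper (M N : 'M['O(U)]_2) :
  upper_triangular M -> upper_triangular N ->
  exists z, commutator M N = z *: delta_mx 0 1.
Proof.
move=> uM uN; exists (commutator M N 0 1).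
have M10 : M 1 0 = 0 by exact: uM.
have N10 : N 1 0 = 0 by exact: uN.
by apply: matrix2P; rewrite /commutator !(mul2E, mxE) /= ?M10 ?N10; ring.
Qed.

Let C := commutator (rep_res rho U [:: 0]) (rep_res rho U [:: 1]).

Let C_conj : exists z, C = P *m (z *: delta_mx 0 1) *m P'.
Proof.
have [_ _ _ _ rep] := ad; have [A uA AE] := rep [:: 0].
have [B uB BE] := rep [:: 1]; have [z zE] := commutator_upper uA uB.
exists z; rewrite -zE /C AE BE /commutator !conjK.
by rewrite -mulmxBl -mulmxBr.
Qed.

Let C_unit (z : 'O(U)) : C = P *m (z *: delta_mx 0 1) *m P' -> germ_unit x z.
Proof.
move=> CE; apply: contrapT => nz; have loc := @sch_local X x.
have vC : vanishes x C.
  rewrite CE; apply: vanishesMr => //; apply: vanishesMl => //.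
  by move=> i j; rewrite mxE => /germ_unit_mull.
have [_ _ _ gT _] := ad.
(* The contradiction comes from [E_11, E_12] = E_12: both conjugates by P lie in the generated
   algebra, and undoing the conjugation exposes an entry equal to 1. *)
have v01 : vanishes x (commutator (P *m delta_mx 0 0 *m P')
                                  (P *m delta_mx 0 1 *m P')).
  apply: (generated_commutative rho_rep loc Ux); try exact/gT/unit_upper.
  have v0 k :
      vanishes x (commutator (rep_res rho U [:: k]) (rep_res rho U [:: k])).
    by rewrite /commutator subrr; exact: vanishes0.
  move=> i j; case: (ord2P i) (ord2P j) => -> [] -> //.
  by rewrite commutator_skew -scaleN1r; exact: vanishesZ.
have : vanishes x (P' *m commutator (P *m delta_mx 0 0 *m P')
                                    (P *m delta_mx 0 1 *m P') *m P).
  by apply: vanishesMr => //; exact: vanishesMl.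
rewrite /commutator !conjK !mul_delta_mx_cond /= mulr1n mulr0n.
rewrite mulmx0 mul0mx subr0 !mulmxA P'P mul1mx -mulmxA P'P mulmx1.
by move=> /(_ 0 1); rewrite mxE; apply; exact: germ_unit1.
Qed.

Let D_at : 'M['O(U)]_2 := C *m sympl _.

(** From P^-1 J = det(P)^-1 J P^T one gets C J = z det(P)^-1 P E_11 P^T, whereas e e^T = a^2 P E_11
    P^T. The ratio a^2 det(P) z^-1 is a unit near x. *)
Let frame_square :
  exists V : opens X, exists h : V `<=` U, oset V x /\ exists k : 'O(V),
    is_unit k /\ map_mx (rs_res h) (e *m e^T) = k *: map_mx (rs_res h) D_at.
Proof.
have [a ea] := frame_direction; have [z zC] := C_conj.
have [V [hV [Vx uaV]]] := frame_unit ea.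
have [W [hW [Wx uzW]]] := C_unit zC.
have [d dE] := mul_sympl P; have [d' d'E] := mul_sympl P'.
(* Transforming J by P' and then by P gives J back; its entry (1, 0) is 1, which isolates the scalar
   d d'. *)
have dd' : d * d' = 1.
  have : P *m (P' *m sympl _ *m P'^T) *m P^T = (d * d') *: sympl _.
    by rewrite d'E -scalemxAr -scalemxAl dE scalerA mulrC.
  rewrite !mulmxA PP' mul1mx -mulmxA -trmx_mul PP' trmx1 mulmx1.
  by move=> /matrixP/(_ 1 0); rewrite !mxE /= subr0 mulr1.
have P'K : P' *m sympl _ = d' *: (sympl _ *m P^T).
  by rewrite scalemxAl -d'E -mulmxA -trmx_mul PP' trmx1 mulmx1.
have e_sq : (z * d') *: (e *m e^T) = (a * a) *: D_at.
  have -> : D_at = (z * d') *: (P *m delta_mx 0 0 *m P^T).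
    rewrite /D_at zC -(mulmxA _ P') P'K -!scalemxAr -!scalemxAl scalerA.
    congr (_ *: _); first exact: mulrC.
    rewrite !mulmxA -(mulmxA P (delta_mx 0 1)); congr (_ *m _ *m _).
    by rewrite /sympl mulmxBr !mul_delta_mx_cond /= mulr1n mulr0n subr0.
  rewrite ea linearZ /= -scalemxAl -scalemxAr trmx_mul trmx_delta.
  rewrite !mulmxA -(mulmxA P _ (delta_mx 0 0)) mul_delta_mx !scalerA.
  by congr (_ *: _); ring.
pose Z := opensI V W; have lV : Z `<=` V by move=> ? [].
have lW : Z `<=` W by move=> ? [].
have lU : Z `<=` U by move=> ? [/hV].
exists Z, lU; split=> //.
have [r zr] : is_unit (rs_res lU z).
  by rewrite -(rs_res_comp hW lW); exact: is_unit_rmorph.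
have ua : is_unit (rs_res lU a).
  by rewrite -(rs_res_comp hV lV); exact: is_unit_rmorph.
(* This is the quotient of a^2 by z d' read off [e_sq], with r inverse to z and d inverse to d'. *)
exists (r * rs_res lU d * (rs_res lU a * rs_res lU a)); split.
  apply: is_unitM; last exact: is_unitM.
  apply: is_unitM; first by exists (rs_res lU z); rewrite mulrC.
  by exists (rs_res lU d'); rewrite -rmorphM dd' rmorph1.
rewrite -scalerA -rmorphM -map_mxZ -e_sq map_mxZ scalerA rmorphM.
have -> : r * rs_res lU d * (rs_res lU z * rs_res lU d') =
    rs_res lU z * r * rs_res lU (d * d') by rewrite rmorphM; ring.
by rewrite zr dd' rmorph1 mulr1 scale1r.
Qed.

Let global_D : 'M[globsec X]_2 :=
  commutator (rho [:: 0]) (rho [:: 1]) *m sympl _.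

Lemma adapted_frame :
  exists V : opens X, oset V x /\ exists (f : 'cV['O(V)]_2) (k : 'O(V)),
    [/\ @generates X (free_sheaf X 2) L V f, is_unit k
      & f *m f^T = k *: map_mx (@rs_res X (opensT X) V (@subsetT X V)) global_D].
Proof.
have [V [h [Vx [k [uk kE]]]]] := frame_square.
exists V; split=> //; exists (map_mx (rs_res h) e), k; split=> //.
  exact: (generates_res h gen_e).
rewrite map_trmx -map_mxM kE; congr (_ *: _).
rewrite -(@map_res_comp X 2 2 (opensT X) U V (@subsetT X U) h).
congr map_mx; rewrite map_mxM map_commutator; congr (_ *m _).
by rewrite /sympl map_mxB !map_delta_mx.
Qed.

End Adapted.

Lemma local_frame (x : X) :
  exists V : opens X, oset V x /\ exists (f : 'cV['O(V)]_2) (k : 'O(V)),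
    [/\ @generates X (free_sheaf X 2) L V f, is_unit k
      & f *m f^T = k *: map_mx (@rs_res X (opensT X) V (@subsetT X V))
          (commutator (rho [:: 0]) (rho [:: 1]) *m sympl _)].
Proof.
by have [U Ux [e [P [P' ad]]]] := adapted_at x; exact: (adapted_frame Ux ad).
Qed.

End LocalFrame.

Theorem proposition4p7
    (X : scheme) (rho : free_monoid 2 -> 'M[globsec X]_2)
    (hX : is_Rep_B rho)
    (L : subSheaf (free_sheaf X 2))
    (hL : is_invariant_line_subbundle rho L) :
  exists (L2 : modSheaf X)
         (t : bilinMor (subsheaf_sheaf L) (subsheaf_sheaf L) L2),
    is_tensor_product t /\ mod_iso L2 (structure_sheaf X).
Proof. exact: (symmetric_square_trivial (local_frame hX.1 hL)). Qed.
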